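(* For every $r\geq 3$ there exists a quasi-linear, head-tail-mixing $r$-graph $F$ which admits the descriptive sequence $X X\cdots X Z Z Y Y\cdots Y$ (consisting of $r-2$ letters $X$, followed by two letters $Z$, followed by $r-2$ letters $Y$).
   Context: An $r$-graph is an $r$-uniform hypergraph. A hypergraph $H$ is quasi-linear if for every edge $e$ there is a unique other edge $f$ (its twin) with $|e\cap f|=2$, and every edge $f'\notin\{e,f\}$ satisfies $|e\cap f'|\leq1$. A descriptive sequence of order $k$ is a sequence $\sigma=(s_1,\dots,s_{2k-2})$ over $\{X,Y,Z\}$ with exactly $k-2$ letters $X$, $k-2$ letters $Y$ and two letters $Z$. Given a linearly ordered vertex set and two $k$-edges $e,f$ with $|e\cap f|=2$, sort $e\cup f$ as $w_1\prec\dots\prec w_{2k-2}$; $\sigma$ describes $\{e,f\}$ if either ($s_i=X$ iff $w_i\in e\setminus f$, $s_i=Y$ iff $w_i\in f\setminus e$, $s_i=Z$ iff $w_i\in e\cap f$) or the same holds with $e,f$ swapped. A quasi-linear hypergraph admits $\sigma$ if there is a linear order of its vertex set in which every twin pair of edges is described by $\sigma$. Given a linear order on the vertices, the head of an edge is the set of its two smallest vertices and its tail is the set of its two largest vertices. A hypergraph is head-tail-mixing if for every linear order of its vertex set there exist edges $e,f$ such that the head of $e$ equals the tail of $f$. *)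

(* Defs.v *)
From HB Require Import structures.
From mathcomp Require Import all_boot.

Set Implicit Arguments.
Unset Strict Implicit.
Unset Printing Implicit Defensive.

(* A (finite) hypergraph on the vertex set V is given by its set of edges
   E : {set {set V}}. *)

Definition uniform (V : finType) (r : nat) (E : {set {set V}}) : Prop :=
  forall e, e \in E -> #|e| = r.

Definition twin (V : finType) (E : {set {set V}}) (e f : {set V}) : bool :=
  [&& f \in E, f != e & #|e :&: f| == 2].

Definition quasi_linear (V : finType) (E : {set {set V}}) : Prop :=
  forall e, e \in E ->
    exists f, unique (twin E e) f /\
      (forall f', f' \in E -> f' \notin [set e; f] -> #|e :&: f'| <= 1).

(* The order is non-strict: totality implies reflexivity. *)
Definition linear_order (V : finType) (le : rel V) : Prop :=
  [/\ total le, antisymmetric le & transitive le].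

Definition sorted_elems (V : finType) (le : rel V) (A : {set V}) : seq V :=
  sort le (enum A).

Inductive letter : Type := LX | LY | LZ.

Definition letter_eqb (a b : letter) : bool :=
  match a, b with
  | LX, LX | LY, LY | LZ, LZ => true
  | _, _ => false
  end.

Lemma letter_eqP : Equality.axiom letter_eqb.
Proof. by do 2!case; constructor. Qed.

HB.instance Definition _ := hasDecEq.Build letter letter_eqP.

Definition descriptive (k : nat) (s : seq letter) : bool :=
  [&& size s == 2 * k - 2, count_mem LX s == k - 2,
      count_mem LY s == k - 2 & count_mem LZ s == 2].

(* all2 also requires s and sorted_elems le (e :|: f) to have the same size. *)
Definition describes_ordered (V : finType) (le : rel V) (s : seq letter)
    (e f : {set V}) : bool :=
  all2 (fun a w => [&& (a == LX) == (w \in e :\: f),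
                       (a == LY) == (w \in f :\: e)
                     & (a == LZ) == (w \in e :&: f)])
       s (sorted_elems le (e :|: f)).

Definition describes (V : finType) (le : rel V) (s : seq letter)
    (e f : {set V}) : bool :=
  describes_ordered le s e f || describes_ordered le s f e.

Definition admits (V : finType) (E : {set {set V}}) (s : seq letter) : Prop :=
  exists2 le : rel V, linear_order le &
    forall e f, e \in E -> twin E e f -> describes le s e f.

Definition head_of (V : finType) (le : rel V) (e : {set V}) : {set V} :=
  [set x in take 2 (sorted_elems le e)].

Definition tail_of (V : finType) (le : rel V) (e : {set V}) : {set V} :=
  [set x in drop (#|e| - 2) (sorted_elems le e)].

Definition head_tail_mixing (V : finType) (E : {set {set V}}) : Prop :=
  forall le : rel V, linear_order le ->
    exists e f, [/\ e \in E, f \in E & head_of le e = tail_of le f].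

Definition xzzy_seq (k : nat) : seq letter :=
  nseq (k - 2) LX ++ nseq 2 LZ ++ nseq (k - 2) LY.

Lemma xzzy_seq_descriptive (k : nat) : 2 <= k -> descriptive k (xzzy_seq k).
Proof.
case: k => [|[|k]] // _; rewrite /descriptive /xzzy_seq.
have -> : 2 * k.+2 - 2 = k + (2 + k) by rewrite !mulnS addKn mul2n -addnn addnCA.
rewrite !subSS subn0 !size_cat !size_nseq !count_cat !count_nseq /=.
by rewrite !mul0n !mul1n !addn0 !add0n !eqxx.
Qed.

(* Main.v *)
(* Put [m] columns of points side by side and consider the "lines" of integer
   slope; two of them share at most one point. On each line choose [k = 2r - 2]
   points, listed by column, and take the first [r] and the last [r] of them as a
   twin pair: ordering the points by column, every such family admits the
   descriptive sequence. For any other order, Ramsey's theorem provides on every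
   line a choice of [k] points along which the order is monotone, and a single
   line where the actual choice is monotone already gives a head equal to a tail.
   With [N = O(q)] points and [q ^ 2] lines, at most [(c - 1) ^ (q ^ 2)] of the
   [c ^ (q ^ 2)] choices fail for a given order, where [c] does not depend on [q];
   as there are at most [(N + 1) ^ N] orders, for large [q] some choice works for
   all of them. *)
Require Import Defs.
From mathcomp Require Import all_boot.
From mathcomp Require Import zify.

Set Implicit Arguments.
Unset Strict Implicit.
Unset Printing Implicit Defensive.

(** * Monotone subsequences *)

(** Ramsey-style induction on [a + b]: the first element [x] splits the others into those above and
    those below it. One part keeps at least half of the bound, and [x] prolongs a monotone
    subsequence found there if it runs in the matching direction. *)
Lemma monotone_subseq (T : eqType) (f : T -> nat) (a b : nat) (s : seq T) :
    injective f -> uniq s -> 2 ^ (a + b) <= size s ->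
  exists2 t, subseq t s &
    (size t == a) && sorted (relpre f ltn) t ||
    (size t == b) && sorted (relpre f gtn) t.
Proof.
move=> f_inj; have [n] := ubnP (a + b).
elim: n => // n IHn in a b s *; case: a => [|a]; first by exists [::]; rewrite ?sub0seq.
case: b => [|b]; first by exists [::]; rewrite ?sub0seq ?orbT.
rewrite addSn addnS !ltnS => lt_ab_n; case: s => [|x s] /=.
  by rewrite leqn0 expn_eq0.
case/andP=> xNs s_uniq le_s.
pose gt_s := [seq y <- s | f x < f y]; pose lt_s := [seq y <- s | f y < f x].
have size_gt_lt : size gt_s + size lt_s = size s.
  rewrite !size_filter -(count_predC (fun y => f x < f y) s); congr (_ + _).
  apply: eq_in_count => y y_s /=; rewrite -leqNgt [RHS]leq_eqVlt.
  by rewrite (inj_eq f_inj); case: eqP y_s => // ->; rewrite (negPf xNs).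
have [le_gt|lt_gt] := leqP (2 ^ (a + b.+1)) (size gt_s).
  have [//||//|t sub_t] := IHn a b.+1 gt_s; rewrite ?filter_uniq //; first by lia.
  have sub_ts := subseq_trans sub_t (filter_subseq _ _).
  case/orP=> /andP[size_t sort_t]; last first.
    by exists t; [exact: subseq_trans (subseq_cons _ _) | rewrite size_t sort_t orbT].
  exists (x :: t); first by rewrite /= eqxx.
  rewrite /= eqSS size_t /= path_sortedE ?sort_t ?andbT; last first.
    by move=> ? ? ?; apply: ltn_trans.
  rewrite (_ : all _ t) //; apply/allP=> y /(mem_subseq sub_t).
  by rewrite mem_filter => /andP[].
have [||//|t sub_t] := IHn a.+1 b lt_s; rewrite ?filter_uniq //.
  by move: le_s lt_gt; rewrite !addSn !addnS !expnS; lia.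
have sub_ts := subseq_trans sub_t (filter_subseq _ _).
case/orP=> /andP[size_t sort_t].
  by exists t; [exact: subseq_trans (subseq_cons _ _) | rewrite size_t sort_t].
exists (x :: t); first by rewrite /= eqxx.
rewrite /= !eqSS size_t /= orbC path_sortedE ?sort_t ?andbT; last first.
  by move=> ? ? ? /= h1 h2; apply: ltn_trans h2 h1.
rewrite (_ : all _ t) //; apply/allP=> y /(mem_subseq sub_t).
by rewrite mem_filter => /andP[].
Qed.

(** * Numerical estimates for the counting argument *)

(** Bernoulli's inequality: raising the base from [c] to [c.+1] gains a factor 2 for every [c.+1]
    factors. *)
Lemma double_expn_leq (c : nat) : 2 * c ^ c.+1 <= c.+1 ^ c.+1.
Proof.
have bern n : c ^ n.+1 + n.+1 * c ^ n <= c.+1 ^ n.+1.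
  elim: n => [|n IHn]; first by rewrite !expn1 expn0 addn1.
  rewrite [c.+1 ^ _]expnS; apply: leq_trans (leq_mul (leqnn c.+1) IHn).
  by rewrite ![c ^ _.+1]expnS; nia.
by apply: leq_trans (bern c); rewrite [c ^ _]expnS; nia.
Qed.

Lemma ltn_mul_succ_expn2 (a : nat) : exists u, a * u.+1 < 2 ^ u.
Proof.
exists (a + a).+1; have := ltn_expl a (isT : 1 < 2).
rewrite expnS expnD; nia.
Qed.

Lemma ltn_poly_expn2 (M d : nat) : exists s, (M * s).+1 ^ d < 2 ^ s.
Proof.
have [u lt_u] := ltn_mul_succ_expn2 (d * M.+1).
(* With [s = 2 ^ u] one has [M * s + 1 <= 2 ^ (M + u)], so comparing exponents of 2 suffices. *)
exists (2 ^ u); apply: leq_ltn_trans (_ : 2 ^ (d * (M.+1 * u.+1)) < _); last first.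
  by rewrite ltn_exp2l // mulnA.
rewrite [d * _]mulnC expnM; case: d {lt_u} => [//|d]; rewrite leq_exp2r //.
have := ltn_expl M (isT : 1 < 2); have : 0 < 2 ^ u by rewrite expn_gt0.
move=> u_gt0 ltM; apply: leq_trans (_ : 2 ^ (M + u) <= _).
  by rewrite expnD; nia.
by rewrite leq_exp2l //; nia.
Qed.

(** Here [m * (m * q)] is the number of grid points, [q * q] the number of lines and [c.+1] the
    number of choices per line. *)
Lemma exists_counting_size (m c : nat) : exists q,
  (m * (m * q)).+1 ^ (m * (m * q)) * c ^ (q * q) < c.+1 ^ (q * q).
Proof.
have [s lt_s] := ltn_poly_expn2 (m * m * c.+1) (m * m).
have s_gt0 : 0 < s by case: s lt_s => //; rewrite muln0 exp1n.
(* Now [q * q = c.+1 * (q * s)]: the lines yield [q * s] doublings, and [2 ^ (q * s)] exceeds the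
   number of rank functions. *)
exists (c.+1 * s); set q := c.+1 * s.
have -> : q * q = c.+1 * (q * s) by rewrite /q; nia.
have q_gt0 : 0 < q by rewrite muln_gt0.
have -> : m * (m * q) = m * m * q by rewrite mulnA.
have lt_q : (m * m * q).+1 ^ (m * m * q) < 2 ^ (q * s).
  by rewrite (expnM _ (m * m)) [q * s]mulnC (expnM 2) ltn_exp2r // /q mulnA.
have [->|c_gt0] := posnP c; first by rewrite (@exp0n (1 * (q * s))) ?muln0 ?exp1n // mul1n muln_gt0 q_gt0.
apply: (@leq_trans (2 ^ (q * s) * c ^ (c.+1 * (q * s)))).
  by rewrite ltn_pmul2r // expn_gt0 c_gt0.
rewrite !(expnM _ c.+1) -expnMn leq_exp2r.
  exact: double_expn_leq.
by rewrite muln_gt0 q_gt0.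
Qed.

(** * The union bound *)

(** For a fixed [rho] the failing functions form a product in which every factor misses at least one
    element of [C]; the union of these sets over all [rho] is too small to contain every
    function. *)
Lemma exists_choice_meeting_all (L C R : finType) (P : pred R)
    (good : R -> L -> pred C) :
    (forall rho l, P rho -> exists c, good rho l c) ->
    #|R| * #|C|.-1 ^ #|L| < #|C| ^ #|L| ->
  exists phi : {ffun L -> C}, forall rho, P rho -> exists l, good rho l (phi l).
Proof.
move=> goodE lt_card.
pose bad rho : {set {ffun L -> C}} :=
  if P rho then [set phi in family (fun l => [predC good rho l])] else set0.
have card_bad rho : #|bad rho| <= #|C|.-1 ^ #|L|.
  rewrite /bad; case: ifP => [P_rho|_]; last by rewrite cards0.
  rewrite cardsE card_family -(prod_nat_const L).
  rewrite foldrE big_map big_enum /=.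
  apply: leq_prod => l _; have [c good_c] := goodE rho l P_rho.
  have : 0 < #|good rho l| by apply/card_gt0P; exists c.
  rewrite -(cardC (good rho l)); case: #|good rho l| => // n _.
  exact: leq_addl.
have [phi phi_good] : exists phi, phi \notin \bigcup_rho bad rho.
  apply/existsP; rewrite -negb_forall; apply/negP=> /forallP bad_all.
  move: lt_card; rewrite ltnNge -card_ffun => /negP[].
  apply: (@leq_trans #|\bigcup_rho bad rho|).
    by apply: subset_leq_card; apply/subsetP=> phi _; exact: bad_all.
  apply: leq_trans (_ : \sum_rho #|bad rho| <= _).
    elim/big_rec2: _ => [|rho n A _ leA]; first by rewrite cards0.
    by rewrite (leq_trans (leq_card_setU _ _)) ?leq_add2l.
  by rewrite -sum_nat_const leq_sum.
exists phi => rho P_rho; apply/existsP; apply: contraNT phi_good => /existsPn none.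
apply/bigcupP; exists rho => //; rewrite /bad P_rho inE; apply/familyP=> l.
by rewrite inE none.
Qed.

(** * Sorted lists and ranks in a linear order *)

Lemma all2_nseq_cat (S T : Type) (p : S -> T -> bool) (a : S) (u v : seq T) (s : seq S) :
  all2 p (nseq (size u) a ++ s) (u ++ v) = all (p a) u && all2 p s v.
Proof. by elim: u => //= x u ->; rewrite andbA. Qed.

Lemma sorted_elems_seq (V : finType) (le : rel V) (s : seq V) :
  linear_order le -> uniq s -> sorted le s -> sorted_elems le [set x in s] = s.
Proof.
case=> le_total le_asym le_trans s_uniq s_sorted.
apply: (sorted_eq le_trans le_asym) => //; first exact: sort_sorted.
rewrite /sorted_elems perm_sort; apply: uniq_perm => //; first exact: enum_uniq.
by move=> x; rewrite mem_enum inE.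
Qed.

(** Encodes orders in a finite type, so that they can be counted. The rank of a point is the size of
    its down-set, which may equal [#|V|]; hence the successor in the codomain. *)
Lemma linear_order_rank (V : finType) (le : rel V) : linear_order le ->
  exists2 rk : {ffun V -> 'I_#|V|.+1}, injectiveb rk &
    forall x y, rk x < rk y -> le x y.
Proof.
case=> le_total le_asym le_trans.
pose down x := [set y | le y x].
have down_sub x y : le x y -> down x \subset down y.
  by move=> le_xy; apply/subsetP=> z; rewrite !inE => /le_trans; apply.
exists [ffun x => inord #|down x|].
  apply/injectiveP=> x y /(congr1 (@nat_of_ord _)); rewrite !ffunE !inordK ?ltnS ?max_card //.
  wlog le_xy : x y / le x y => [IH|] eq_card.
    by have [/IH|/IH h] := orP (le_total x y); [apply | apply/esym/h].
  have eq_down : down x = down y.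
    by apply/eqP; rewrite eqEcard down_sub // eq_card leqnn.
  have := in_set (le^~ y) y; rewrite -/(down y) -eq_down inE.
  have /orP[->|->] := le_total y y => le_yx; by apply: le_asym; rewrite le_xy.
move=> x y; rewrite !ffunE !inordK ?ltnS ?max_card //; apply: contraTT => nle_xy.
rewrite -leqNgt subset_leq_card // down_sub //.
by have := le_total x y; rewrite (negPf nle_xy).
Qed.

(* The two twins [A Z] and [Z B] cut out of a sequence [A Z B] with [|Z| = 2]. *)
Definition twin_edge (V : finType) (r : nat) (b : bool) (s : seq V) : {set V} :=
  [set x in if b then take r s else drop (r - 2) s].

(** * A single twin pair *)

Section TwinEdges.

Variables (V : finType) (r : nat) (s : seq V).
Hypotheses (r_ge3 : 3 <= r) (s_uniq : uniq s) (size_s : size s = 2 * r - 2).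

Let A := take (r - 2) s.
Let Z := take 2 (drop (r - 2) s).
Let B := drop r s.

Lemma twin_edge_split : [/\ s = A ++ Z ++ B, take r s = A ++ Z & drop (r - 2) s = Z ++ B].
Proof.
have dropE : drop (r - 2) s = Z ++ B.
  by rewrite /Z /B -[in drop r s](subnK (ltnW r_ge3)) addnC -drop_drop cat_take_drop.
have sE : s = A ++ Z ++ B by rewrite -dropE cat_take_drop.
split=> //; rewrite {1}sE catA take_size_cat // size_cat !size_take_min size_drop size_s.
by lia.
Qed.

Lemma twin_edge_sizes : [/\ size A = r - 2, size Z = 2 & size B = r - 2].
Proof. by rewrite /A /Z /B !size_take_min !size_drop size_s; split; lia. Qed.

Lemma card_twin_edge b : #|twin_edge r b s| = r.
Proof.
rewrite cardsE; case: b.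
  by rewrite (card_uniqP (take_uniq _ s_uniq)) size_take_min size_s; lia.
by rewrite (card_uniqP (drop_uniq _ s_uniq)) size_drop size_s; lia.
Qed.

Lemma mem_twin_edge b x : x \in twin_edge r b s -> x \in s.
Proof. by case: b; rewrite inE; [apply: mem_take | apply: mem_drop]. Qed.

(** Reduces set identities to Boolean cases on the blocks [A], [Z], [B]; the two implications
    express that the blocks are pairwise disjoint. *)
Lemma twin_edge_mems x :
  [/\ (x \in twin_edge r true s) = (x \in A) || (x \in Z),
      (x \in twin_edge r false s) = (x \in Z) || (x \in B),
      x \in A -> (x \in Z) || (x \in B) = false &
      x \in Z -> (x \in A) || (x \in B) = false].
Proof.
have [sE AZ ZB] := twin_edge_split; rewrite !inE AZ ZB !mem_cat.
move: s_uniq; rewrite sE !cat_uniq has_cat negb_or.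
case/and5P=> _ /andP[/hasPn ZA /hasPn BA] _ /hasPn BZ _; split=> //.
  move=> xA; apply: contraTF xA => /orP[/ZA//|/BA//].
move=> xZ; apply: contraTF xZ => /orP[xA|/BZ//]; by apply: contraL xA => /ZA.
Qed.

Lemma twin_edgesU : twin_edge r true s :|: twin_edge r false s = [set x in s].
Proof.
have [sE _ _] := twin_edge_split; apply/setP=> x; have [e1 e2 _ _] := twin_edge_mems x.
rewrite in_setU e1 e2 inE [in RHS]sE !mem_cat.
by case: (x \in A); case: (x \in Z).
Qed.

Lemma card_twin_edgesI b : #|twin_edge r b s :&: twin_edge r (~~ b) s| = 2.
Proof.
suff -> : twin_edge r b s :&: twin_edge r (~~ b) s = [set x in Z].
  by rewrite cardsE (card_uniqP _) ?take_uniq ?drop_uniq //; case: twin_edge_sizes.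
wlog -> : b / b = true => [IH|].
  case: b; first exact: IH.
  by rewrite setIC; apply: (IH true).
apply/setP=> x; have [e1 e2 xA xZ] := twin_edge_mems x.
rewrite in_setI e1 e2 inE; move: xA xZ.
by case: (x \in A); case: (x \in Z); case: (x \in B) => // /(_ isT).
Qed.

Lemma describes_twin_edges (le : rel V) b : linear_order le -> sorted le s ->
  describes le (xzzy_seq r) (twin_edge r b s) (twin_edge r (~~ b) s).
Proof.
move=> le_lin s_sorted.
suff desc : describes_ordered le (xzzy_seq r) (twin_edge r true s) (twin_edge r false s).
  by case: b; rewrite /describes desc ?orbT.
rewrite /describes_ordered twin_edgesU sorted_elems_seq //.
have [sizeA sizeZ sizeB] := twin_edge_sizes; have [sE _ _] := twin_edge_split.
rewrite [X in all2 _ _ X]sE /xzzy_seq -[in nseq _ LX]sizeA -[in nseq _ LZ]sizeZ -sizeB.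
(* Appending empty lists lets the last block be split off like the first two. *)
rewrite !all2_nseq_cat -[nseq _ LY]cats0 -[X in all2 _ _ X]cats0 all2_nseq_cat /= andbT.
apply/and3P; split; apply/allP=> x x_in;
  have [e1 e2 xA xZ] := twin_edge_mems x; rewrite !in_setD in_setI e1 e2; move: xA xZ;
  move: x_in => ->; case: (x \in A); case: (x \in Z); case: (x \in B) => // xA xZ;
  first [by have := xA isT | by have := xZ isT].
Qed.

(** The common value is the block [Z]: it ends [A Z] and starts [Z B], and reversing the order
    exchanges these roles. *)
Lemma head_tail_twin_edges (le : rel V) : linear_order le ->
    sorted le s || sorted le (rev s) ->
  exists b, head_of le (twin_edge r b s) = tail_of le (twin_edge r (~~ b) s).
Proof.
move=> le_lin; have [_ AZ ZB] := twin_edge_split; have [sizeA sizeZ sizeB] := twin_edge_sizes.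
have le_trans : transitive le by case: le_lin.
rewrite /head_of /tail_of; case/orP=> s_sorted.
  exists false; rewrite card_twin_edge /= !sorted_elems_seq ?take_uniq ?drop_uniq //.
  - by rewrite AZ ZB take_size_cat // drop_size_cat.
  - exact: take_sorted.
  - exact: drop_sorted.
exists true; rewrite card_twin_edge /=.
have revE b : twin_edge r b s = [set x in rev (if b then take r s else drop (r - 2) s)].
  by apply/setP=> x; rewrite !inE mem_rev.
rewrite !revE !sorted_elems_seq ?rev_uniq ?take_uniq ?drop_uniq //.
- by rewrite AZ ZB !rev_cat take_size_cat ?drop_size_cat ?size_rev //.
- by apply: subseq_sorted s_sorted; rewrite // subseq_rev drop_subseq.
- by apply: subseq_sorted s_sorted; rewrite // subseq_rev take_subseq.
Qed.

End TwinEdges.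

(** * Twin pairs cut out of a linear system of sequences *)

Section TwinFamily.

Variables (L V : finType) (r : nat) (valid : pred L) (p : L -> seq V).
Hypotheses (r_ge3 : 3 <= r) (p_uniq : forall l, valid l -> uniq (p l)).
Hypothesis size_p : forall l, valid l -> size (p l) = 2 * r - 2.
Hypothesis p_linear : forall l l' x y, x != y ->
  x \in p l -> y \in p l -> x \in p l' -> y \in p l' -> l = l'.

Definition twin_family : {set {set V}} :=
  [set twin_edge r z.2 (p z.1) | z : L * bool & valid z.1].

Lemma twin_familyP e : reflect (exists l b, valid l /\ e = twin_edge r b (p l))
  (e \in twin_family).
Proof.
apply: (iffP imsetP) => [[[l b]]|[l [b [l_valid ->]]]]; last first.
  by exists (l, b); rewrite ?inE.
by rewrite inE /= => l_valid ->; exists l, b.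
Qed.

Lemma twin_family_linear l l' b b' : l != l' ->
  #|twin_edge r b (p l) :&: twin_edge r b' (p l')| <= 1.
Proof.
apply: contra_neqT; rewrite -ltnNge => /card_gt1P[x [y [/setIP[xl xl'] /setIP[yl yl'] xNy]]].
exact: p_linear xNy (mem_twin_edge xl) (mem_twin_edge yl)
  (mem_twin_edge xl') (mem_twin_edge yl').
Qed.

Lemma uniform_twin_family : uniform r twin_family.
Proof. by move=> _ /twin_familyP[l [b [l_valid ->]]]; rewrite card_twin_edge ?p_uniq ?size_p. Qed.

(** Edges from different sequences share at most one point, so only the other half of the same
    sequence can meet an edge in two. *)
Lemma twin_in_family l b f : valid l ->
  twin twin_family (twin_edge r b (p l)) f = (f == twin_edge r (~~ b) (p l)).
Proof.
move=> l_valid; have := card_twin_edgesI r_ge3 (p_uniq l_valid) (size_p l_valid) b.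
move=> cardI; apply/and3P/eqP => [[/twin_familyP[l' [b' [_ ->]]] fNe /eqP card2]|->].
  have [eq_l|/(twin_family_linear b b')] := eqVneq l l'; last by rewrite card2.
  rewrite -eq_l in fNe *; have [eq_b|] := eqVneq b' b; first by rewrite eq_b eqxx in fNe.
  by case: (b') (b) => [] [].
split; first by apply/twin_familyP; exists l, (~~ b).
  (* The halves are distinct because they meet in 2 points, fewer than [r]. *)
  apply: contra_eqN cardI => /eqP->.
  by rewrite setIid card_twin_edge ?p_uniq ?size_p //; lia.
by rewrite cardI.
Qed.

Lemma quasi_linear_twin_family : quasi_linear twin_family.
Proof.
move=> _ /twin_familyP[l [b [l_valid ->]]]; exists (twin_edge r (~~ b) (p l)); split.
  by split=> [|f]; rewrite twin_in_family // => /eqP.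
move=> _ /twin_familyP[l' [b' [_ ->]]]; rewrite !inE.
have [<-|/twin_family_linear-> //] := eqVneq l l'.
by case: b b' => [] []; rewrite eqxx ?orbT.
Qed.

Lemma admits_twin_family (le : rel V) : linear_order le ->
  (forall l, valid l -> sorted le (p l)) -> admits twin_family (xzzy_seq r).
Proof.
move=> le_lin p_sorted; exists le => // _ f /twin_familyP[l [b [l_valid ->]]].
rewrite twin_in_family // => /eqP->.
by apply: describes_twin_edges; rewrite ?p_uniq ?size_p ?p_sorted.
Qed.

Lemma head_tail_mixing_twin_family :
  (forall le : rel V, linear_order le ->
     exists2 l, valid l & sorted le (p l) || sorted le (rev (p l))) ->
  head_tail_mixing twin_family.
Proof.
move=> p_mono le le_lin; have [l l_valid l_mono] := p_mono le le_lin.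
have [b eq_b] := head_tail_twin_edges r_ge3 (p_uniq l_valid) (size_p l_valid) le_lin l_mono.
exists (twin_edge r b (p l)), (twin_edge r (~~ b) (p l)).
by split=> //; apply/twin_familyP; exists l; [exists b | exists (~~ b)].
Qed.

End TwinFamily.

(** * Lines of integer slope in a grid *)

Section GridLines.

Variables m q : nat.

Lemma line_bound (l : 'I_q * 'I_q) (i : 'I_m) : l.1 + i * l.2 < m * q.
Proof.
case: l => x v /=; have := ltn_ord i; have := ltn_ord x; have := ltn_ord v.
case: m i => [|n] i lt_v lt_x lt_i; first by case: i {lt_i}.
by rewrite mulSn -addSn leq_add // leq_mul // ltnW.
Qed.

(* The line of slope [l.2] through [(0, l.1)]; its second coordinate grows
   without wrapping around, so no field arithmetic is needed. *)
Definition line_point (l : 'I_q * 'I_q) (i : 'I_m) : 'I_m * 'I_(m * q) :=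
  (i, Ordinal (line_bound l i)).

Lemma line_point_inj l : injective (line_point l).
Proof. by move=> i j []. Qed.

(** Distinct points of a line lie in distinct columns [i] and [j]; subtracting the two height
    equations forces equal slopes, then equal intercepts. *)
Lemma line_point_linear l l' (s s' : seq 'I_m) x y : x != y ->
    x \in map (line_point l) s -> y \in map (line_point l) s ->
    x \in map (line_point l') s' -> y \in map (line_point l') s' ->
  l = l'.
Proof.
move=> xNy /mapP[i _ xE] /mapP[j _ yE] /mapP[i' _ xE'] /mapP[j' _ yE'].
have iNj : i != j by apply: contraNneq xNy => ij; rewrite xE yE ij.
move: xE' yE'; rewrite xE yE => -[<- eq_i] [<- eq_j].
case: l l' eq_i eq_j {xE yE} => [a v] [a' v'] /= eq_i eq_j.
have eq_v : v = v'.
  by apply: ord_inj; have : (i : nat) <> j by [move/ord_inj/eqP; apply/negP]; nia.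
by congr (_, _) => //; apply: ord_inj; move: eq_i; rewrite eq_v => /addIn.
Qed.

(** A line meets each column once, so heights serve only to break ties within a column. *)
Definition column_order : rel ('I_m * 'I_(m * q)) :=
  fun u v => (u.1 < v.1) || ((u.1 : nat) == v.1) && (u.2 <= v.2).

Lemma column_order_linear : linear_order column_order.
Proof.
rewrite /column_order; split.
- by move=> u v; lia.
- move=> [i x] [j y] /= h; have [? ?] : (i : nat) = j /\ (x : nat) = y by lia.
  by congr (_, _); apply: ord_inj.
- by move=> u v w; lia.
Qed.

End GridLines.

(** * Construction of the hypergraph *)

Theorem theorem3p3 (r : nat) (hr : 3 <= r) :
  exists (V : finType) (E : {set {set V}}),
    [/\ uniform r E, quasi_linear E, head_tail_mixing E & admits E (xzzy_seq r)].
Proof.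
(* A twin pair spans [k] points, and [2 ^ (k + k)] columns guarantee a monotone choice of [k] of
   them. [C] holds all tuples, increasing or not; [good] and [valid] select the increasing ones. *)
pose k := 2 * r - 2; pose m := 2 ^ (k + k); pose C : finType := k.-tuple 'I_m.
have [q lt_q] := exists_counting_size m #|C|.-1.
pose V : finType := ('I_m * 'I_(m * q))%type; pose L : finType := ('I_q * 'I_q)%type.
pose R : finType := {ffun V -> 'I_#|V|.+1}; pose incr (t : C) := sorted (relpre val ltn) t.
pose rank_on (rk : R) l (i : 'I_m) : nat := rk (line_point l i).
pose good (rk : R) (l : L) (t : C) := incr t &&
  (sorted (relpre (rank_on rk l) ltn) t || sorted (relpre (rank_on rk l) gtn) t).
have good_exists (rk : R) (l : L) : injectiveb rk -> exists t, good rk l t.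
  move=> /injectiveP rk_inj.
  have f_inj : injective (rank_on rk l).
    by move=> i j /ord_inj/rk_inj/line_point_inj.
  have [||t sub_t] := @monotone_subseq _ _ k k (enum 'I_m) f_inj.
  - exact: enum_uniq.
  - by rewrite size_enum_ord.
  rewrite -andb_orr => /andP[size_t mono_t]; exists (Tuple size_t).
  rewrite /good mono_t andbT /incr.
  apply: subseq_sorted sub_t _; first by move=> ? ? ?; apply: ltn_trans.
  by rewrite -sorted_map val_enum_ord iota_ltn_sorted.
have C_gt0 : 0 < #|C| by rewrite card_tuple card_ord expn_gt0 expn_gt0.
have [|phi phi_good] := exists_choice_meeting_all good_exists.
  by rewrite card_ffun card_ord !card_prod !card_ord; move: lt_q; rewrite prednK.
pose valid l := incr (phi l); pose p l := map (line_point l) (phi l).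
have p_uniq l : valid l -> uniq (p l).
  move=> incr_l; rewrite map_inj_uniq; last exact: line_point_inj.
  by apply: sorted_uniq incr_l => [? ? ?|?] /=; [apply: ltn_trans | rewrite ltnn].
have size_p l : valid l -> size (p l) = 2 * r - 2 by rewrite size_map size_tuple.
have p_linear l l' x y : x != y ->
    x \in p l -> y \in p l -> x \in p l' -> y \in p l' -> l = l'.
  exact: line_point_linear.
exists V, (twin_family r valid p); split.
- exact: uniform_twin_family.
- exact: quasi_linear_twin_family.
- apply: head_tail_mixing_twin_family => // le le_lin.
  have [rk rk_inj rk_le] := linear_order_rank le_lin.
  (* On this line the chosen points are monotone in rank, hence in [le]. *)
  have [l /andP[l_valid mono_l]] := phi_good rk rk_inj; exists l => //.
  rewrite rev_sorted !sorted_map.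
  by case/orP: mono_l => h; apply/orP; [left | right];
    apply: sub_sorted h => i j /= /rk_le.
- apply: admits_twin_family (column_order_linear m q) _ => // l l_valid.
  by rewrite sorted_map; apply: sub_sorted l_valid => i j; rewrite /column_order /= => ->.
Qed.
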